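(* Let $B\ge2$ and $K$ an integer with $1\le K\le B/2$. Let $\mathcal Y\subseteq\mathbb{R}$ be bounded with $M=\sup\mathcal Y-\inf\mathcal Y>0$, and $\mathcal X\subseteq[\inf\mathcal Y,\sup\mathcal Y]^B$. Let $$\mathcal H_{BSF}=\Big\{x\in\mathcal X\mapsto w\,e\cdot x:\ w\in\{1,\tfrac12,\ldots,\tfrac1K\},\ e\in\{0,1\}^B,\ \textstyle\sum_{i=1}^Be_i=w^{-1}\Big\}.$$ Let $S=\{(x_1,y_1),\ldots,(x_n,y_n)\}$ be drawn i.i.d. from a distribution $\mathcal D$ on $\mathcal X\times\mathcal Y$. Then for any $\delta\in(0,1)$, with probability at least $1-\delta$, for all $h\in\mathcal H_{BSF}$, $$R(h)\le\widehat R_S(h)+M^2\sqrt{\frac{K\log B+\log\frac{1}{\delta\,(K-1)!}}{2n}}.$$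
   Context: $R(h)=\mathbb{E}_{(x,y)\sim\mathcal D}[(h(x)-y)^2]$ and $\widehat R_S(h)=\frac1n\sum_{i=1}^n(h(x_i)-y_i)^2$. Each $h\in\mathcal H_{BSF}$ is the uniform average of the predictions of a subset of at most $K$ of the $B$ trees of a forest; $x$ is the vector of tree predictions and $S$ is the validation set. *)

(* Defs.v *)
From HB Require Import structures.
From mathcomp Require Import all_boot all_order all_algebra.
From mathcomp Require Import all_classical all_reals all_analysis.
Set Implicit Arguments. Unset Strict Implicit. Unset Printing Implicit Defensive.
Import Order.TTheory GRing.Theory Num.Theory.
Local Open Scope classical_set_scope.
Local Open Scope ring_scope.

(* A data point: a vector of B tree predictions (x) and a label (y). *)
Definition datum (R : realType) (B : nat) := (B.-tuple R * R)%type.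

Definition HBSF (R : realType) (B K : nat) : set (B.-tuple R -> R) :=
  [set h | exists k : nat, (1 <= k <= K)%N /\
     exists e : 'I_B -> bool, (\sum_(j < B) (e j : nat))%N = k /\
       h = (fun x => k%:R^-1 * \sum_(j < B) (e j)%:R * tnth x j)].

(* Mutual independence of a finite family of random variables Z_0..Z_{n-1}:
   product rule for every family of measurable sets (taking A_i = setT for
   indices outside a subfamily recovers every finite subfamily). *)
Definition mutually_independent (R : realType) d (Omega : measurableType d)
  (P : probability Omega R) d' (T : measurableType d') (n : nat)
  (Z : 'I_n -> Omega -> T) : Prop :=
  forall A : 'I_n -> set T, (forall i, measurable (A i)) ->
    P [set w | forall i, A i (Z i w)] = (\prod_(i < n) P (Z i @^-1` A i))%E.

Definition iid_sample (R : realType) d (Omega : measurableType d)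
  (P : probability Omega R) d' (T : measurableType d') (D : probability T R)
  (n : nat) (Z : 'I_n -> Omega -> T) : Prop :=
  (forall i, measurable_fun [set: Omega] (Z i)) /\
  (forall i (A : set T), measurable A -> P (Z i @^-1` A) = D A) /\
  mutually_independent P Z.

Definition risk (R : realType) (B : nat) (D : probability (datum R B) R)
  (h : B.-tuple R -> R) : \bar R :=
  (\int[D]_z ((h z.1 - z.2) ^+ 2)%:E)%E.

Definition emp_risk (R : realType) (B n : nat) (S : 'I_n -> datum R B)
  (h : B.-tuple R -> R) : R :=
  n%:R^-1 * \sum_(i < n) (h (S i).1 - (S i).2) ^+ 2.

(* Main.v *)
Require Import Defs.
From HB Require Import structures.
From mathcomp Require Import all_boot all_order all_algebra.
From mathcomp Require Import all_classical all_reals all_analysis.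
From mathcomp Require Import measurable_realfun.
From mathcomp Require Import ring lra.
Import Order.TTheory GRing.Theory Num.Theory.
Local Open Scope classical_set_scope.
Local Open Scope ring_scope.

(* A hypothesis of the class is determined by the nonempty set of at most [K]
   trees that it averages, and since binomial coefficients increase up to
   [B / 2], there are at most [K * 'C(B, K) <= B ^ K / (K - 1)!] such sets.  For
   a single hypothesis the squared loss takes values in [0, M^2], so Hoeffding's
   inequality bounds the probability that the risk exceeds the empirical risk by
   more than [t] by [exp (- 2 * n * t^2 / M^4)]; a union bound over the class
   concludes. *)

(** * Expectation of a product of independent factors *)

Section weighted_change_of_variables.
Import HBNNSimple.

(** Both sides are linear in [f] and continuous along nondecreasing sequences, so the identity
    passes from indicators to simple functions and then to nonnegative measurable [f]. The weight
    [g] is meant to hold the remaining factors of a product. *)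
Lemma ge0_integral_comp_weighted (R : realType) (d1 d2 : measure_display)
    (T1 : measurableType d1) (T2 : measurableType d2)
    (mu : {measure set T1 -> \bar R}) (nu : {measure set T2 -> \bar R})
    (Z : T1 -> T2) (g : T1 -> R) (k : R) (f : T2 -> R) :
  measurable_fun setT Z -> measurable_fun setT g -> (forall x, 0 <= g x) ->
  0 <= k ->
  (forall A, measurable A ->
     (\int[mu]_x (g x * \1_A (Z x))%:E = k%:E * nu A)%E) ->
  measurable_fun setT f -> (forall y, 0 <= f y) ->
  (\int[mu]_x (g x * f (Z x))%:E = k%:E * \int[nu]_y (f y)%:E)%E.
Proof.
move=> mZ mg g0 k0 gZ mf f0.
have mEf : measurable_fun setT (EFin \o f) by exact/measurable_EFinP.
pose h := nnsfun_approx measurableT mEf.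
have h_cvg y : EFin \o h^~ y @ \oo --> (f y)%:E.
  by apply: (@cvg_nnsfun_approx _ _ _ _ _ _ mEf) => // z _; rewrite lee_fin.
have h_nd m n y : (m <= n)%N -> h m y <= h n y.
  by move=> mn; exact/lefP/nd_nnsfun_approx.
have mhZ n : measurable_fun setT (fun x => g x * h n (Z x)).
  apply: measurable_funM => //.
  by apply: (measurableT_comp (f := h n)).
transitivity (limn (fun n => \int[mu]_x (g x * h n (Z x))%:E)%E).
  rewrite -monotone_convergence//.
  - apply: eq_integral => x _; apply/esym/cvg_lim => //.
    under eq_fun do rewrite EFinM.
    by rewrite EFinM; exact/cvgeZl/h_cvg.
  - by move=> n; exact/measurable_EFinP.
  - by move=> n x _; rewrite lee_fin mulr_ge0.
  - by move=> x _ m n mn; rewrite lee_fin ler_wpM2l// h_nd.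
transitivity (limn (fun n => k%:E * \int[nu]_y (h n y)%:E)%E); last first.
  rewrite limeMl//.
  - congr (_ * _)%E; rewrite -monotone_convergence//.
    + apply: eq_integral => y _; apply/cvg_lim => //. exact: h_cvg.
    + by move=> n; exact/measurable_EFinP.
    + by move=> n y _; rewrite lee_fin.
    + by move=> y _ m n mn; rewrite lee_fin h_nd.
  - apply: ereal_nondecreasing_is_cvgn => m n mn.
    apply: ge0_le_integral => //.
    + by move=> y _; rewrite lee_fin.
    + exact/measurable_EFinP.
    + exact/measurable_EFinP.
    + by move=> y _; rewrite lee_fin h_nd.
apply: congr_lim; apply/funext => n.
rewrite integralT_nnsfun sintegralE ge0_mule_fsumr; last first.
  by move=> y; exact: nnsfun_mulemu_ge0.
have mh1 r : measurable_fun setT (fun x => g x * \1_(h n @^-1` [set r]) (Z x)).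
  apply: measurable_funM => //.
  have m1 : measurable_fun setT (\1_(h n @^-1` [set r]) : T2 -> R).
    exact: measurable_indic.
  exact: measurableT_comp m1 mZ.
(* The simple function is split along its finitely many level sets, to whose indicators [gZ]
   applies. *)
have step x : (g x * h n (Z x))%:E =
    (\sum_(r \in range (h n)) (r * (g x * \1_(h n @^-1` [set r]) (Z x)))%:E)%E.
  rewrite fsumEFin//; congr EFin; rewrite {1}(fimfunE (h n)).
  rewrite mulr_fsumr//; apply: eq_fsbigr => r _.
  by rewrite mulrCA.
under eq_integral do rewrite step.
rewrite ge0_integral_fsum//; last 2 first.
- by move=> r; apply/measurable_EFinP; exact: measurable_funM.
- move=> r x _.
  have := nnfun_muleindic_ge0 (h n) r (Z x).
  by rewrite !lee_fin mulrCA => ?; rewrite mulr_ge0.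
apply: eq_fsbigr => r; rewrite inE => -[y _ <-].
under eq_integral do rewrite EFinM.
rewrite ge0_integralZl_EFin//.
- by rewrite gZ// muleCA.
- by move=> x _; rewrite lee_fin mulr_ge0// indicE ler0n.
- exact/measurable_EFinP.
Qed.

End weighted_change_of_variables.

Lemma indic_forall (R : comPzRingType) (T U : Type) (n : nat)
    (Z : 'I_n -> U -> T) (A : 'I_n -> set T) (w : U) :
  \prod_(i < n) \1_(A i) (Z i w) =
  \1_[set w | forall i, A i (Z i w)] w :> R.
Proof.
rewrite [RHS]indicE; set S := [set w | _]; have [Aw|Aw] := boolP (w \in S).
  rewrite big1// => i _; rewrite indicE.
  by move: Aw; rewrite inE => /(_ i); rewrite -in_setE => ->.
have [i Ai] : exists i, ~ A i (Z i w).
  by apply/existsNP; move: Aw; rewrite notin_setE.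
by rewrite (bigD1 i)//= indicE memNset// mul0r.
Qed.

(** Independence is given for events only; it is lifted to functions by induction on the number [m]
    of leading coordinates at which [f i] may fail to be an indicator. *)
Lemma integral_prod_iid (R : realType) (d d' : measure_display)
    (Omega : measurableType d) (P : probability Omega R)
    (T : measurableType d') (D : probability T R) (n : nat)
    (Z : 'I_n -> Omega -> T) (f : 'I_n -> T -> R) (a : 'I_n -> R) :
  iid_sample P D Z ->
  (forall i, measurable_fun setT (f i)) -> (forall i z, 0 <= f i z) ->
  (forall i, \int[D]_z (f i z)%:E = (a i)%:E)%E ->
  (\int[P]_w (\prod_(i < n) f i (Z i w))%:E = (\prod_(i < n) a i)%:E)%E.
Proof.
move=> [mZ [lawZ indZ]].
(* Indicators are replaced by the [f i] one coordinate at a time. *)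
suff ind m : (forall i, measurable_fun setT (f i)) ->
    (forall i z, 0 <= f i z) ->
    (forall i, \int[D]_z (f i z)%:E = (a i)%:E)%E ->
    (forall i : 'I_n, (m <= i)%N -> exists2 A, measurable A & f i = \1_A) ->
    (\int[P]_w (\prod_(i < n) f i (Z i w))%:E = (\prod_(i < n) a i)%:E)%E.
  move=> mf f0 fa; apply: (ind n) => // i.
  by rewrite leqNgt ltn_ord.
elim: m f a => [|m IH] f a mf f0 fa fA.
  have /choice[A mA] : forall i, exists A, measurable A /\ f i = \1_A.
    by move=> i; have [A mA fE] := fA i (leq0n i); exists A.
  have aE i : (a i)%:E = P (Z i @^-1` A i).
    rewrite -fa; have [mAi ->] := mA i.
    by rewrite integral_indic// setIT lawZ.
  under eq_integral.
    move=> w _; under eq_bigr do rewrite (mA _).2.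
    rewrite indic_forall; over.
  rewrite integral_indic//; last first.
    rewrite (_ : [set _ | _] = \bigcap_(i in [set: 'I_n]) (Z i @^-1` A i)).
      apply: fin_bigcap_measurable => // i _; rewrite -[X in measurable X]setTI.
      by apply: mZ => //; exact: (mA i).1.
    by apply/seteqP; split => w Aw i => [_|]; exact: Aw.
  rewrite setIT; transitivity (\prod_(i < n) P (Z i @^-1` A i))%E.
    by apply: indZ => i; exact: (mA i).1.
  rewrite -prodEFin; apply: eq_bigr => i _; exact/esym/aE.
(* For [n <= m] there is no coordinate of index [m], so the induction hypothesis already covers the
   claim. *)
have [mn|nm] := ltnP m n; last first.
  apply: IH => // i mi; apply: fA.
  by have := leq_ltn_trans mi (ltn_ord i); rewrite ltnNge nm.
pose j := Ordinal mn.
have mg : measurable_fun setT (fun w => \prod_(i < n | i != j) f i (Z i w)).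
  under eq_fun do rewrite -big_filter.
  by apply: measurable_prod => i _; exact: measurableT_comp (mf i) (mZ i).
have a0 i : 0 <= a i.
  by rewrite -lee_fin -fa integral_ge0// => z _; rewrite lee_fin.
under eq_integral do rewrite (bigD1 j)//= mulrC.
rewrite (bigD1 j)//= mulrC EFinM -fa.
(* Coordinate [j] is the integrated function and the product of the others is the weight. The
   hypothesis on indicators is then the induction hypothesis, with [f j] replaced by [\1_A]. *)
apply: ge0_integral_comp_weighted => //.
- by move=> w; apply: prodr_ge0.
- by apply: prodr_ge0.
move=> A mA.
pose f' i := if i == j then \1_A else f i.
pose a' i := if i == j then fine (D A) else a i.
transitivity (\int[P]_w (\prod_(i < n) f' i (Z i w))%:E)%E.
  apply: eq_integral => w _; rewrite [in RHS](bigD1 j)//= {1}/f' eqxx mulrC.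
  congr (EFin (_ * _)); apply: eq_bigr => i /negbTE ij.
  by rewrite /f' ij.
rewrite (IH f' a').
- rewrite (bigD1 j)//= {1}/a' eqxx EFinM fineK ?fin_num_measure// muleC.
  congr (EFin _ * _)%E.
  by apply: eq_bigr => i /negbTE ij; rewrite /a' ij.
- by move=> i; rewrite /f'; case: ifP => // _; exact: measurable_indic.
- by move=> i z; rewrite /f'; case: ifP => // _; rewrite indicE ler0n.
- move=> i; rewrite /f' /a'; case: ifP => // _.
  by rewrite integral_indic// setIT fineK ?fin_num_measure.
- move=> i mi; rewrite /f'; case: ifPn => [_|ij]; first by exists A.
  by apply: fA; rewrite ltn_neqAle mi andbT eq_sym.
Qed.

(** * Hoeffding's lemma and Hoeffding's inequality *)

(** This is Hoeffding's lemma for a Bernoulli variable. The right side divided by the left is 1 at 0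
    and nondecreasing on the nonnegative reals. *)
Lemma bernoulli_mgf_le (R : realType) (p u : R) : 0 <= p <= 1 -> 0 <= u ->
  1 - p + p * expR u <= expR (p * u + u ^+ 2 / 8).
Proof.
move=> /andP[p0 p1] u0.
pose m (x : R) : R := 1 - p + p * expR x.
have m_gt0 x : 0 < m x.
  rewrite /m; have := expR_gt0 x; nra.
have dV (x : R) : is_derive x 1 (fun y => (m y)^-1)
    (- (m x) ^- 2 *: (p * expR x)).
  apply: is_deriveV; first exact: lt0r_neq0.
  by apply: is_derive_eq; rewrite /GRing.scale/=; ring.
(* [g] is the logarithmic derivative of the ratio [k] of the two sides; its
   derivative is [1/4 - q * (1 - q) >= 0] with [q := p * expR x / m x]. *)
pose g (x : R) : R := p + x / 4 - p * expR x / m x.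
pose dg (x : R) : R := 4^-1 - (p * expR x / m x) * (1 - p * expR x / m x).
have dgE (x : R) : is_derive x 1 g (dg x).
  have dmV := dV x.
  rewrite /g; apply: is_derive_eq.
  rewrite /dg /GRing.scale/=.
  have := lt0r_neq0 (m_gt0 x); move: (m x) => y y0.
  by field.
have dg_ge0 x : 0 <= dg x.
  rewrite /dg; set q := p * _ / _.
  have -> : 4^-1 - q * (1 - q) = (q - 2^-1) ^+ 2 by field.
  exact: sqr_ge0.
have g_ge0 x : 0 <= x -> 0 <= g x.
  move=> x0; have g00 : g 0 = 0 by rewrite /g /m expR0 mulr1 subrK; field.
  rewrite -[X in X <= _]g00.
  apply: (@ger0_derive1_le_cc _ g 0 x); rewrite ?in_itv/= ?lexx ?x0//.
  - by move=> y _; rewrite derive1E derive_val.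
  - by apply: derivable_within_continuous => y _; have [] := dgE y.
pose k (x : R) : R := expR (p * x + x ^+ 2 / 8) / m x.
suff : 1 <= k u by rewrite /k ler_pdivlMr// mul1r.
have dk (x : R) : is_derive x 1 k (k x * g x).
  have dmV := dV x.
  have de : is_derive x 1 (fun x => p * x + x ^+ 2 / 8) (p + x / 4).
    by apply: is_derive_eq; rewrite /GRing.scale/=; field.
  have dE := is_derive1_comp (is_derive_expR _) de.
  rewrite /k; apply: is_derive_eq.
  rewrite /g /k /GRing.scale/=.
  have := lt0r_neq0 (m_gt0 x); move: (m x) => y y0.
  by field.
have k01 : k 0 = 1.
  by rewrite /k /m expR0 mulr0 expr0n/= mul0r addr0 expR0 mulr1 subrK divr1.
rewrite -[X in X <= _]k01.
apply: (@ger0_derive1_le_cc _ k 0 u); rewrite ?in_itv/= ?lexx ?u0//.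
- move=> y; rewrite in_itv/= => /andP[y0 _]; rewrite derive1E derive_val.
  by rewrite mulr_ge0 ?g_ge0 ?(ltW y0)// divr_ge0 ?expR_ge0// ltW.
- by apply: derivable_within_continuous => y _; have [] := dk y.
Qed.

(** Convexity of the exponential: its tangent at [t * u] lies below it at [0] and at [u], and these
    two inequalities are averaged with weights [1 - t] and [t]. *)
Lemma expR_chord_le (R : realType) (t u : R) : 0 <= t <= 1 ->
  expR (t * u) <= 1 - t + t * expR u.
Proof.
move=> /andP[t0 t1].
have e0 := expR_gt0 (t * u).
have h1 : expR (t * u) * (1 - t * u) <= 1.
  have := expR_ge1Dx (- (t * u)); rewrite expRN => h.
  by rewrite mulrC -ler_pdivlMr// mul1r.
have h2 : expR (t * u) * (1 + (u - t * u)) <= expR u.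
  have -> : expR u = expR (t * u) * expR (u - t * u).
    by rewrite -expRD; congr expR; ring.
  by rewrite ler_wpM2l ?(ltW e0)// expR_ge1Dx.
have h1' : (1 - t) * (expR (t * u) * (1 - t * u)) <= (1 - t) * 1.
  by rewrite ler_wpM2l// subr_ge0.
have h2' := ler_wpM2l t0 h2.
have := lerD h1' h2'; rewrite mulr1; apply: le_trans.
by rewrite le_eqVlt; apply/orP; left; apply/eqP; ring.
Qed.

Lemma bounded_integrable (R : realType) (d : measure_display)
    (T : measurableType d) (D : probability T R) (g : T -> R) (b : R) :
  measurable_fun setT g -> (forall z, 0 <= g z <= b) ->
  D.-integrable setT (EFin \o g).
Proof.
move=> mg gb; apply: (le_integrable measurableT (g := EFin \o cst b)).
- exact/measurable_EFinP.
- move=> z _ /=; rewrite lee_fin.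
  have /andP[g0 gz] := gb z.
  by rewrite !ger0_norm// (le_trans g0).
- exact: finite_measure_integrable_cst.
Qed.

Section bounded_loss.
Context (R : realType) (d' : measure_display) (T : measurableType d').
Variables (D : probability T R) (f : T -> R) (c mean : R).
Hypothesis c_gt0 : 0 < c.
Hypothesis mf : measurable_fun setT f.
Hypothesis f_itv : forall z, 0 <= f z <= c.
Hypothesis mean_f : (\int[D]_z (f z)%:E = mean%:E)%E.

Lemma integral_affine (a b : R) :
  (\int[D]_z (a + b * f z)%:E = (a + b * mean)%:E)%E.
Proof.
have fi := bounded_integrable _ _ _ D _ _ mf f_itv.
transitivity
  (\int[D]_z ((EFin \o cst a) \+ (EFin \o (fun z => (b * f z)%R))) z)%E.
  by [].
rewrite integralD_EFin//.
- rewrite [X in (_ + X)%E](_ : _ = \int[D]_z (b%:E * (f z)%:E))%E//.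
  rewrite integralZl// mean_f.
  rewrite [X in (X + _)%E](_ : _ = \int[D]_z cst a%:E z)%E//.
  by rewrite integral_cst// [X in (_ * X)%E]probability_setT mule1.
- exact: finite_measure_integrable_cst.
- exact: (integrableZl measurableT b fi).
Qed.

Lemma mean_itv : 0 <= mean <= c.
Proof.
have := integral_affine c (-1); have := mean_f => h1 h2.
apply/andP; split.
  rewrite -lee_fin -h1 integral_ge0// => z _.
  by rewrite lee_fin; case/andP: (f_itv z).
rewrite -subr_ge0 -mulN1r -lee_fin -h2 integral_ge0// => z _.
by rewrite lee_fin mulN1r subr_ge0; case/andP: (f_itv z).
Qed.

(** By convexity the worst case is the law on the endpoints [0] and [c] with the same mean, which is
    the Bernoulli case after rescaling. *)
Lemma hoeffding_mgf (s : R) : 0 <= s ->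
  (\int[D]_z (expR (s * (mean - f z)))%:E <= (expR ((s * c) ^+ 2 / 8))%:E)%E.
Proof.
move=> s0.
have /andP[m0 mc] := mean_itv.
(* [p] is the mean of [1 - f z / c]; this reflection turns the deviation below the mean into a
   Bernoulli bound with nonnegative parameter [s * c]. *)
pose p := 1 - mean / c.
have p01 : 0 <= p <= 1.
  by rewrite /p subr_ge0 gerBl ler_pdivrMr// mul1r mc divr_ge0// ltW.
pose A := expR (- (s * (c * p))).
have A0 : 0 < A by exact: expR_gt0.
(* The affine bound is the chord of [expR (s * (mean - y))] between [y = 0] and [y = c]. *)
apply: (@le_trans _ _ (\int[D]_z
    (A * expR (s * c) + (A * (1 - expR (s * c)) / c) * f z)%:E)%E).
  apply: ge0_le_integral => //.
  - apply/measurable_EFinP; apply: measurableT_comp => //.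
    by apply: measurable_funM => //; exact: measurable_funB.
  - apply/measurable_EFinP; apply: measurable_funD => //.
    exact: measurable_funM.
  - move=> z _; rewrite lee_fin.
    pose t := 1 - f z / c.
    have t01 : 0 <= t <= 1.
      have /andP[f0 fc] := f_itv z.
      by rewrite /t subr_ge0 gerBl ler_pdivrMr// mul1r fc divr_ge0// ltW.
    have -> : s * (mean - f z) = - (s * (c * p)) + t * (s * c).
      by rewrite /t /p; field; rewrite gt_eqF.
    rewrite expRD -/A.
    have -> : A * expR (s * c) + A * (1 - expR (s * c)) / c * f z
        = A * (1 - t + t * expR (s * c)).
      by rewrite /t; field; rewrite gt_eqF.
    by rewrite ler_wpM2l ?(ltW A0)// expR_chord_le.
rewrite integral_affine lee_fin.
have -> : A * expR (s * c) + A * (1 - expR (s * c)) / c * mean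
  = A * (1 - p + p * expR (s * c)).
  by rewrite /p; field; rewrite gt_eqF.
apply: (le_trans (ler_wpM2l (ltW A0) (bernoulli_mgf_le _ _ _ p01 _))).
  by rewrite mulr_ge0// ltW.
rewrite /A -expRD ler_expR le_eqVlt; apply/orP; left; apply/eqP.
ring.
Qed.

(** Chernoff's method: Markov's inequality for the exponential of [s] times the sum of the
    [mean - f (Z i w)], whose expectation factors by independence and is bounded by
    [hoeffding_mgf]. *)
Lemma hoeffding (d : measure_display) (Omega : measurableType d)
    (P : probability Omega R) (n : nat) (Z : 'I_n -> Omega -> T) (t : R) :
  (0 < n)%N -> iid_sample P D Z -> 0 < t ->
  (P [set w | (n%:R^-1 * \sum_(i < n) f (Z i w) + t < mean)%R] <=
   (expR (- (2 * n%:R * t ^+ 2 / c ^+ 2)))%:E)%E.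
Proof.
move=> n0 iidZ t0; set E := [set w | _].
have mZ i : measurable_fun setT (Z i) by case: iidZ.
have n_gt0 : 0 < n%:R :> R by rewrite ltr0n.
have mfZ i : measurable_fun setT (fun w => f (Z i w)).
  exact: measurableT_comp mf (mZ i).
have mE : measurable E.
  rewrite -[E]setTI; apply: (@measurable_lte _ _ _ _ measurableT
    (fun w => (n%:R^-1 * \sum_(i < n) f (Z i w) + t)%:E) (fun=> mean%:E)) => //.
  apply/measurable_EFinP; apply: measurable_funD => //.
  by apply: measurable_funM => //; exact: measurable_sum.
(* the minimiser of [- s * n * t + n * (s * c)^2 / 8] *)
pose s := 4 * t / c ^+ 2.
have s0 : 0 < s by rewrite divr_gt0 ?exprn_gt0// mulr_gt0.
pose a := fine (\int[D]_z (expR (s * (mean - f z)))%:E)%E.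
have mexp : measurable_fun setT (fun z => expR (s * (mean - f z))).
  apply: measurableT_comp => //.
  by apply: measurable_funM => //; exact: measurable_funB.
have aE : (\int[D]_z (expR (s * (mean - f z)))%:E = a%:E)%E.
  rewrite fineK// ge0_fin_numE.
    exact: le_lt_trans (hoeffding_mgf _ (ltW s0)) (ltry _).
  by apply: integral_ge0 => z _; rewrite lee_fin expR_ge0.
have a_le : a <= expR ((s * c) ^+ 2 / 8).
  by rewrite -lee_fin -aE hoeffding_mgf// ltW.
have a_ge0 : 0 <= a.
  by rewrite -lee_fin -aE integral_ge0// => z _; rewrite lee_fin expR_ge0.
have int := @integral_prod_iid _ _ _ _ _ _ _ _ Z
  (fun=> fun z => expR (s * (mean - f z))) (fun=> a) iidZ
  (fun=> mexp) (fun _ _ => expR_ge0 _) (fun=> aE).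
pose k := expR (s * n%:R * t).
have k_gt0 : 0 < k by exact: expR_gt0.
(* On [E] the sum of the [mean - f (Z i w)] exceeds [n * t], so the product of exponentials is at
   least [k]; off [E] it is still nonnegative. *)
have markov : (k%:E * P E <= (\prod_(i < n) a)%:E)%E.
  rewrite -int -[E]setIT -integral_indic// -ge0_integralZl_EFin//; last 2 first.
  - by apply/measurable_EFinP; exact: measurable_indic.
  - exact: ltW.
  apply: ge0_le_integral => //.
  - by move=> w _; rewrite mule_ge0// lee_fin ?indicE ?ler0n// ltW.
  - apply: measurable_funeM; apply/measurable_EFinP; exact: measurable_indic.
  - apply/measurable_EFinP; apply: measurable_prod => i _.
    exact: measurableT_comp mexp (mZ i).
  - move=> w _; rewrite -EFinM lee_fin indicE.
    have [|_] := boolP (w \in E); last first.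
      by rewrite mulr0 prodr_ge0// => i _; exact: expR_ge0.
    rewrite inE /E/= mulr1 -expR_sum ler_expR => Ew.
    rewrite -mulr_sumr -mulrA ler_pM2l// sumrB sumr_const card_ord.
    move: Ew; rewrite -(ltr_pM2l n_gt0) mulrDr mulVKf ?gt_eqF//.
    rewrite -[mean *+ n]mulr_natl.
    by move=> Ew; rewrite lerBrDl ltW.
have kE : (P E <= (k^-1 * \prod_(i < n) a)%:E)%E.
  by rewrite EFinM lee_pdivlMl.
apply: (le_trans kE); rewrite lee_fin prodr_const card_ord.
apply: (@le_trans _ _ (k^-1 * expR ((s * c) ^+ 2 / 8) ^+ n)).
  rewrite ler_wpM2l ?invr_ge0 ?(ltW k_gt0)//.
  by rewrite lerXn2r// nnegrE expR_ge0.
rewrite -expRM_natl /k -expRN -expRD ler_expR le_eqVlt.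
apply/orP; left; apply/eqP; rewrite /s; field.
by rewrite gt_eqF.
Qed.

End bounded_loss.

(** * Counting the nonempty sets of at most [K] trees *)

Lemma leq_bin_half (n k : nat) :
  (2 * k.+1 <= n)%N -> ('C(n, k) <= 'C(n, k.+1))%N.
Proof.
move=> kn; rewrite -(leq_pmul2l (ltn0Sn k)) mul_bin_left leq_mul2r.
apply/orP; right; rewrite leq_subRL.
  by apply: leq_trans kn; rewrite mul2n -addnn leq_add2r.
by apply: leq_trans kn; rewrite mul2n -addnn (leq_trans (leqnSn k))// leq_addr.
Qed.

Lemma leq_ffact_expn (n k : nat) : (n ^_ k <= n ^ k)%N.
Proof.
by elim: k => // k IH; rewrite ffactnSr expnSr leq_mul ?leq_subr.
Qed.

Definition small_subsets (B K : nat) : {set {set 'I_B}} :=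
  [set A : {set 'I_B} | (0 < #|A| <= K)%N]%SET.

Lemma card_small_subsets (B K : nat) : (0 < K)%N -> (2 * K <= B)%N ->
  (#|small_subsets B K| * K.-1`! <= B ^ K)%N.
Proof.
move=> K0 KB.
(* The induction descends from [K], so that every size met stays below [B / 2]. *)
have bin_le k : (k <= K)%N -> ('C(B, K - k) <= 'C(B, K))%N.
  elim: k => [|k IH] kK; first by rewrite subn0.
  apply: leq_trans (IH (ltnW kK)); rewrite -(subnSK kK).
  apply: leq_bin_half; rewrite subnSK// (leq_trans _ KB)//.
  by rewrite leq_mul2l leq_subr.
have F_le m : (m <= K)%N -> (#|small_subsets B m| <= m * 'C(B, K))%N.
  elim: m => [_|m IH mK].
    rewrite mul0n leqn0 cards_eq0; apply/eqP/setP => A.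
    by rewrite !inE; case: #|A|.
  rewrite mulSn addnC.
  apply: (@leq_trans (#|small_subsets B m| +
      #|[set A : {set 'I_B} | #|A| == m.+1]%SET|)).
    apply: leq_trans (leq_card_setU _ _); apply: subset_leq_card.
    apply/fintype.subsetP => A; rewrite !inE => /andP[->/=].
    by rewrite leq_eqVlt ltnS orbC.
  rewrite leq_add ?IH ?(ltnW mK)// card_draws card_ord.
  by rewrite -(subKn mK) bin_le// leq_subr.
apply: (@leq_trans (K * 'C(B, K) * K.-1`!)).
  by rewrite leq_mul2r F_le ?orbT.
apply: leq_trans (leq_ffact_expn B K).
rewrite -bin_ffact (_ : K`! = K * K.-1`!)%N; last by case: (K) K0.
by rewrite mulnCA mulnA.
Qed.

(** * Hypotheses as averages over sets of trees *)

Definition subset_avg (R : realType) (B : nat) (A : {set 'I_B})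
    (x : B.-tuple R) : R :=
  #|A|%:R^-1 * \sum_(j < B) (j \in A)%:R * tnth x j.

(** Indexing the class by a finite set of tree sets makes both the union bound and the measurability
    of the good event finite matters. *)
Lemma HBSFP (R : realType) (B K : nat) (h : B.-tuple R -> R) :
  HBSF K h <-> exists2 A, A \in small_subsets B K & h = subset_avg R B A.
Proof.
split=> [[k [k1K [e [ek ->]]]]|[A + ->]].
  have cardA : #|[set j | e j]%SET| = k.
    by rewrite -ek -sum1dep_card big_mkcond; apply: eq_bigr => j _; case: (e j).
  exists [set j | e j]%SET; first by rewrite inE cardA.
  apply/funext => x; rewrite /subset_avg cardA; congr (_ * _).
  by apply: eq_bigr => j _; rewrite inE.
rewrite inE => AK; exists #|A|; split => //.
exists (fun j => j \in A); split => //.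
by rewrite -sum1_card [RHS]big_mkcond; apply: eq_bigr => j _; case: (j \in A).
Qed.

Lemma subset_avg_itv (R : realType) (B : nat) (A : {set 'I_B})
    (x : B.-tuple R) (a b : R) : (0 < #|A|)%N ->
  (forall j, a <= tnth x j <= b) -> a <= subset_avg R B A x <= b.
Proof.
move=> A0 xab; have A_gt0 : 0 < #|A|%:R :> R by rewrite ltr0n.
have cardE y : #|A|%:R * y = \sum_(j < B) (j \in A)%:R * y :> R.
  rewrite -mulr_suml -natr_sum; congr (_%:R * _).
  by rewrite -sum1_card big_mkcond; apply: eq_bigr => j _; case: (j \in A).
rewrite /subset_avg ler_pdivlMl// ler_pdivrMl// !cardE.
by apply/andP; split; apply: ler_sum => j _; rewrite ler_wpM2l//;
  case/andP: (xab j).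
Qed.

Lemma measurable_subset_avg (R : realType) (B : nat) (A : {set 'I_B}) :
  measurable_fun setT (subset_avg R B A).
Proof.
apply: measurable_funM => //; apply: measurable_sum => j.
by apply: measurable_funM => //; exact: measurable_tnth.
Qed.

(** * Deviation of one hypothesis, then the union bound *)

(* Truncating the loss at [c] leaves the risk unchanged and can only decrease
   the empirical risk, so the boundedness needed by Hoeffding's inequality is
   only required almost everywhere. *)
Lemma risk_deviation (R : realType) (B n : nat) (d : measure_display)
    (Omega : measurableType d) (P : probability Omega R)
    (D : probability (datum R B) R) (Z : 'I_n -> Omega -> datum R B)
    (h : B.-tuple R -> R) (c t : R) :
  measurable_fun setT h -> 0 < c ->
  {ae D, forall z : datum R B, (h z.1 - z.2) ^+ 2 <= c} ->
  (0 < n)%N -> iid_sample P D Z -> 0 < t ->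
  (P [set w | (emp_risk (fun i => Z i w) h + t)%:E < risk D h] <=
   (expR (- (2 * n%:R * t ^+ 2 / c ^+ 2)))%:E)%E.
Proof.
move=> mh c0 hc n0 iidZ t0.
pose loss (z : datum R B) : R := (h z.1 - z.2) ^+ 2.
pose f (z : datum R B) : R := Num.min (loss z) c.
have mloss : measurable_fun setT loss.
  apply: measurable_funX; apply: measurable_funB => //.
  exact: measurableT_comp mh measurable_fst.
have mf : measurable_fun setT f by apply: measurable_minr.
have f_itv z : 0 <= f z <= c.
  by rewrite /f le_min sqr_ge0 (ltW c0) ge_min lexx orbT.
have riskE : (risk D h = \int[D]_z (f z)%:E)%E.
  apply: ae_eq_integral => //; [exact/measurable_EFinP|exact/measurable_EFinP|].
  by apply: filterS hc => z lc _; rewrite /f min_l.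
have fi := bounded_integrable _ _ _ D _ _ mf f_itv.
have meanE : (\int[D]_z (f z)%:E = (fine (\int[D]_z (f z)%:E))%:E)%E.
  by rewrite fineK//; exact: (integrable_fin_num measurableT fi).
apply: le_trans
  (hoeffding _ _ _ _ _ _ _ c0 mf f_itv meanE _ _ _ _ _ _ n0 iidZ t0).
have mZ i : measurable_fun setT (Z i) by case: iidZ.
have meas (g : datum R B -> R) (x : \bar R) : measurable_fun setT g ->
    measurable [set w | (((n%:R^-1 * \sum_(i < n) g (Z i w) + t)%R)%:E < x)%E].
  move=> mg; rewrite -[X in measurable X]setTI; apply: measurable_lte => //.
  apply/measurable_EFinP; apply: measurable_funD => //.
  apply: measurable_funM => //; apply: measurable_sum => i.
  exact: measurableT_comp mg (mZ i).
apply: le_measure; rewrite ?inE.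
- exact: (meas loss).
- exact: (meas f (fine (\int[D]_z (f z)%:E))%:E).
- move=> w /=; rewrite riskE meanE lte_fin; apply: le_lt_trans.
  rewrite lerD2r ler_wpM2l ?invr_ge0//; apply: ler_sum => i _.
  by rewrite /f ge_min lexx.
Qed.

Theorem theorem5 (R : realType) (B K : nat) (Ys : set R)
  (Xs : set (B.-tuple R)) (d : measure_display) (Omega : measurableType d)
  (P : probability Omega R) (D : probability (datum R B) R) (n : nat)
  (Z : 'I_n -> Omega -> datum R B) (delta : R) :
  (2 <= B)%N -> (1 <= K)%N -> (2 * K <= B)%N ->
  has_ubound Ys -> has_lbound Ys -> 0 < sup Ys - inf Ys ->
  (forall x, Xs x -> forall j : 'I_B, inf Ys <= tnth x j <= sup Ys) ->
  {ae D, forall z : datum R B, (Xs `*` Ys) z} ->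
  (0 < n)%N -> iid_sample P D Z ->
  0 < delta < 1 ->
  (P [set w | forall h, @HBSF R B K h ->
       (risk D h <=
        (emp_risk (fun i => Z i w) h
         + (sup Ys - inf Ys) ^+ 2 *
           Num.sqrt ((K%:R * ln B%:R + ln ((delta * (K.-1)`!%:R)^-1))
                     / (2 * n%:R)))%:E)%E]
   >= (1 - delta)%:E)%E.
Proof.
move=> B2 K1 KB ubY lbY M0 XsP aeD n0 iidZ /andP[d0 d1].
set M := sup Ys - inf Ys; set L := _ + ln _; set t := _ * Num.sqrt _.
set G := [set w | _].
have B_gt0 : 0 < B%:R :> R by rewrite ltr0n (leq_trans _ B2).
have f_gt0 : 0 < (K.-1)`!%:R :> R by rewrite ltr0n fact_gt0.
have n_gt0 : 0 < n%:R :> R by rewrite ltr0n.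
have c0 : 0 < M ^+ 2 by rewrite exprn_gt0.
have expL : expR L = B%:R ^+ K / (delta * (K.-1)`!%:R).
  rewrite expRD lnK ?posrE ?invr_gt0 ?mulr_gt0//; congr (_ * _).
  by rewrite expRM_natl lnK.
have card_le : #|small_subsets B K|%:R * (K.-1)`!%:R <= B%:R ^+ K :> R.
  by rewrite -natrM -natrX ler_nat card_small_subsets.
(* [L] must be positive for the square root to be genuine, since [Num.sqrt] is 0 on negative
   numbers. As a singleton belongs to [small_subsets B K], its cardinal is at least 1 and exceeds
   [delta]. *)
have L0 : 0 < L.
  rewrite -expR_gt1 expL ltr_pdivlMr ?mulr_gt0// mul1r.
  apply: lt_le_trans card_le; rewrite ltr_pM2r//; apply: (lt_le_trans d1).
  rewrite ler1n card_gt0; apply/set0Pn.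
  exists [set Ordinal (leq_trans (isT : 0 < 2)%N B2)]%SET.
  by rewrite inE cards1.
have t0 : 0 < t by rewrite mulr_gt0// sqrtr_gt0 divr_gt0// mulr_gt0.
pose bad A := [set w | ((emp_risk (fun i => Z i w) (subset_avg R B A) + t)%:E
   < risk D (subset_avg R B A))%E].
have mbad A : measurable (bad A).
  rewrite -[bad A]setTI; apply: measurable_lte => //.
  apply/measurable_EFinP; apply: measurable_funD => //.
  apply: measurable_funM => //; apply: measurable_sum => i.
  apply: measurable_funX; have mZi : measurable_fun setT (Z i) by case: iidZ.
  apply: measurable_funB.
    apply: measurableT_comp (measurable_subset_avg R B A) _.
    exact: measurableT_comp measurable_fst mZi.
  exact: measurableT_comp measurable_snd mZi.
(* [G] quantifies over functions [h]; its measurability comes from writing its complement as a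
   finite union of measurable events. *)
have GE : ~` G = \bigcup_(A in [set` small_subsets B K]) bad A.
  rewrite /G -[RHS]setCK setC_bigcup; congr (~` _).
  apply/seteqP; split=> w /= Gw.
    move=> A AK; apply/negP; rewrite -leNgt; apply: Gw.
    by apply/HBSFP; exists A.
  move=> h /HBSFP[A AK ->]; rewrite leNgt; apply/negP; exact: Gw.
have mGC : measurable (~` G).
  by rewrite GE; apply: fin_bigcup_measurable => // A _; exact: mbad.
have bad_le A : A \in small_subsets B K -> (P (bad A) <= (expR (- L))%:E)%E.
  rewrite inE => /andP[A0 _].
  apply: (le_trans (risk_deviation _ _ _ _ _ _ _ _ _ (M ^+ 2) _
    (measurable_subset_avg R B A) c0 _ n0 iidZ t0)).
    apply: filterS aeD => z [/XsP zX zY].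
    have /andP[h1 h2] := subset_avg_itv R B A z.1 _ _ A0 zX.
    have y1 := ub_le_sup ubY zY; have y2 := ge_inf lbY zY.
    (* Prediction and label both lie in an interval of length [M], so both factors of the difference
       of squares are nonnegative. *)
    by rewrite -subr_ge0 subr_sqr mulr_ge0// /M; lra.
  (* [t] is chosen so that the Hoeffding exponent with [c = M ^+ 2] is exactly [L]. *)
  rewrite lee_fin ler_expR lerN2 le_eqVlt; apply/orP; left; apply/eqP.
  rewrite /t exprMn sqr_sqrtr; last by rewrite divr_ge0 ?(ltW L0)// mulr_ge0.
  by field; rewrite !gt_eqF.
have PGC : (P (~` G) <= delta%:E)%E.
  apply: (@le_trans _ _ (\sum_(A \in [set` small_subsets B K]) P (bad A))%E).
    by apply: content_sub_fsum => //; rewrite GE.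
  apply: (@le_trans _ _
      (\sum_(A \in [set` small_subsets B K]) (expR (- L))%:E)%E).
    by apply: lee_fsum.
  rewrite fsumEFin// lee_fin.
  rewrite -(@bigfs _ _ _ _ (index_enum {set 'I_B})) ?index_enum_uniq//;
    last first.
    by move=> A _; rewrite mem_index_enum.
  rewrite sumr_const.
  rewrite -mulr_natl expRN expL invf_div mulrA ler_pdivrMr ?exprn_gt0//.
  by rewrite mulrCA ler_pM2l.
have mG : measurable G by rewrite -[G]setCK; exact: measurableC.
move: PGC; rewrite probability_setC// leeBlDr ?fin_num_measure//.
by rewrite EFinB leeBlDl.
Qed.
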